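(* Let $b\ge 2$ and let $n_1,\ldots,n_b$ be positive integers. Let $\Delta$ be the squared distance matrix of the starlike block graph $\mathcal{S}(n_1,n_2,\ldots,n_b)$ on $n=1+\sum_{i=1}^b n_i$ vertices. Then the inertia of $\Delta$ is $\operatorname{In}(\Delta)=(1,0,n-1)$.
   Context: The starlike block graph $\mathcal{S}(n_1,\ldots,n_b)$ is the graph consisting of $b\ge 2$ blocks which are the complete graphs $K_{n_1+1},\ldots,K_{n_b+1}$ (each $n_i\ge 1$), all sharing exactly one common vertex, the central cut vertex. For a simple connected graph $G$ with vertices $v_1,\ldots,v_n$, the squared distance matrix is $\Delta(G)=[d(v_i,v_j)^2]$, where $d$ is the shortest-path distance. For a real symmetric matrix $A$, the inertia is the triple $\operatorname{In}(A)=(\mathbf{n}_+(A),\mathbf{n}_0(A),\mathbf{n}_-(A))$, where $\mathbf{n}_+(A)$ is the number of positive eigenvalues, $\mathbf{n}_0(A)$ the multiplicity of the eigenvalue $0$, and $\mathbf{n}_-(A)$ the number of negative eigenvalues (counted with multiplicity). *)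

(* Defs.v *)
From mathcomp Require Import all_boot all_order all_algebra.
From mathcomp Require Import polyrcf.

Set Implicit Arguments.
Unset Strict Implicit.
Unset Printing Implicit Defensive.

Import Order.TTheory GRing.Theory Num.Theory.

Section Distance.
Variables (V : finType) (e : rel V).

Definition has_walk (u v : V) (k : nat) : bool :=
  [exists p : k.-tuple V, path e u p && (last u p == v)].

(* In a connected graph every distance is less than #|V|, so the search over
   k < #|V| is exhaustive; the value is #|V| if u and v are not connected. *)
Definition gdist (u v : V) : nat := find (has_walk u v) (iota 0 #|V|).

Lemma gdist_min u p : path e u p -> gdist u (last u p) <= size p.
Proof.
move=> ep; case/shortenP: ep => p' ep' up' sub_p'.
have le_p' : size p' <= size p.
  by apply: uniq_leq_size sub_p'; case/andP: up'.
apply: leq_trans le_p'; rewrite leqNgt; apply/negP => lt_d.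
have lt_V : size p' < #|V| by rewrite -[X in X <= _]/(size (u :: p')) -(card_uniqP up') max_card.
have /negP[] := negbT (before_find 0 lt_d); rewrite nth_iota // add0n.
by apply/existsP; exists (in_tuple p'); rewrite /= ep' eqxx.
Qed.

Lemma gdist_path u v : connect e u v ->
  exists p, [/\ path e u p, last u p = v & size p = gdist u v].
Proof.
case/connectP => p ep ->; case/shortenP: ep => p' ep' up' _.
have lt_V : size p' < #|V| by rewrite -[X in X <= _]/(size (u :: p')) -(card_uniqP up') max_card.
have hw : has (has_walk u (last u p')) (iota 0 #|V|).
  apply/hasP; exists (size p'); first by rewrite mem_iota add0n.
  by apply/existsP; exists (in_tuple p'); rewrite /= ep' eqxx.
have := nth_find 0 hw; rewrite nth_iota; last by rewrite has_find size_iota in hw.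
rewrite add0n -/(gdist _ _) => /existsP[q /andP[eq /eqP lq]].
by exists q; rewrite size_tuple.
Qed.

End Distance.

Local Open Scope ring_scope.

Definition sqdist_mx (R : nzRingType) (V : finType) (e : rel V) : 'M[R]_#|V| :=
  \matrix_(i, j) ((gdist e (enum_val i) (enum_val j)) ^ 2)%N%:R.

Section Inertia.
Variables (R : rcfType) (m : nat) (A : 'M[R]_m).

(* rootsR is the duplicate-free list of the roots in R of a nonzero polynomial,
   and mup a p is the multiplicity of a as a root of p. Only eigenvalues in R
   are counted, which are all of them when A is symmetric. *)
Definition eigvals : seq R := rootsR (char_poly A).

Definition eigmult (a : R) : nat := mup a (char_poly A).

Definition inertia : nat * nat * nat :=
  ((\sum_(a <- eigvals | (0 < a)%R) eigmult a)%N,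
   eigmult 0,
   (\sum_(a <- eigvals | (a < 0)%R) eigmult a)%N).

Lemma eigvals_uniq : uniq eigvals.
Proof. exact: uniq_roots. Qed.

Lemma mem_eigvals a : (a \in eigvals) = eigenvalue A a.
Proof.
by rewrite eigenvalue_root_char -roots_on_rootsR ?monic_neq0 ?char_poly_monic.
Qed.

End Inertia.

Section Starlike.
Variables (b : nat) (n : 'I_b -> nat).

(* None is the central vertex; Some (Tagged _ j) with tag i is the j-th of the
   n i non-central vertices of the i-th block. *)
Definition starlike_vertex : finType := option {i : 'I_b & 'I_(n i)}.

Definition starlike_block (i : 'I_b) : {set starlike_vertex} :=
  None |: [set Some x | x : {i : 'I_b & 'I_(n i)} & tag x == i].

Definition starlike : rel starlike_vertex := fun u v =>
  (u != v) &&
  [exists i, (u \in starlike_block i) && (v \in starlike_block i)].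

Lemma card_starlike_vertex : #|starlike_vertex| = (1 + \sum_(i < b) n i)%N.
Proof.
rewrite card_option card_tagged sumnE big_map enumT.
by under eq_bigr do rewrite card_ord.
Qed.

Lemma card_starlike_block i : #|starlike_block i| = (n i).+1.
Proof.
rewrite cardsU1 card_imset; last by move=> x y [].
have -> : None \notin [set Some x | x : {i : 'I_b & 'I_(n i)} & tag x == i].
  by apply/negP => /imsetP[].
rewrite add1n; congr _.+1; rewrite -[RHS]card_ord.
rewrite -(card_imset _ (f := @Tagged _ i (fun i => 'I_(n i)))); last first.
  by move=> x y /eqP; rewrite eq_Tagged => /eqP.
apply: eq_card => -[j x]; apply/idP/imsetP => [|[y _ ->]]; last by rewrite inE.
by rewrite inE /= => /eqP eji; case: _ / eji; exists x.
Qed.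

Lemma starlike_blockI i j : i != j ->
  starlike_block i :&: starlike_block j = [set None].
Proof.
move=> ij; apply/setP => -[x|]; rewrite !inE //=.
apply/negP => /andP[/imsetP[y yi [exy]] /imsetP[z zj [exz]]].
move: yi zj ij; rewrite !inE -exy -exz => /eqP-> /eqP->.
by rewrite eqxx.
Qed.

Lemma starlike_sym : symmetric starlike.
Proof.
move=> u v; rewrite /starlike eq_sym; congr (_ && _).
by apply: eq_existsb => i; rewrite andbC.
Qed.

Lemma starlike_irr : irreflexive starlike.
Proof. by move=> u; rewrite /starlike eqxx. Qed.

Lemma starlike_connected u v : connect starlike u v.
Proof.
have c0 w : connect starlike None w.
  case: w => [x|]; last exact: connect0.
  apply: connect1; apply/andP; split=> //; apply/existsP; exists (tag x).
  rewrite !inE /=; apply/imsetP; exists x => //.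
  by rewrite inE.
apply: connect_trans (c0 v).
by rewrite (sym_connect_sym (@starlike_sym)).
Qed.

End Starlike.

(* Main.v *)
Require Import Defs.
From mathcomp Require Import all_boot all_order all_algebra.
From mathcomp Require Import reals.
From mathcomp Require Import complex sesquilinear spectral.
From mathcomp Require Import ring lra.

(** Write a vector indexed by the vertices as its value [f0] at the centre
    together with its values [g] at the other vertices; let [S] be the sum of
    [g] over all non-central vertices and [S_i] its sum over the block [i].
    Distances are 1 inside a block and 2 between non-central vertices of
    different blocks, so the squared distance between two non-central vertices
    is [4 - 3 [same block] - [equal]], and the quadratic form of the matrix is

      [2 f0 S + 4 S^2 - 3 \sum_i S_i^2 - \sum g^2]

    ([starlike_qform]). On the hyperplane [f0 + 4 S = 0] this becomes
    [- 4 S^2 - 3 \sum_i S_i^2 - \sum g^2], which is negative off the origin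
    ([starlike_qform_neg]); on the other hand the form is positive at the sum
    of the basis vectors of two adjacent vertices, because the diagonal of the
    matrix is zero.

    These two facts determine the inertia of any real symmetric matrix
    ([inertia_hyperplane]). If there were two eigenvectors with
    nonnegative eigenvalues, chosen orthogonal, some nonzero combination of
    them would lie in the hyperplane, where the form is negative; and if no
    eigenvalue were positive, the form would be nowhere positive. Hence
    exactly one eigenvalue is nonnegative, and it is positive.

    The inertia counts eigenvalues as roots of the characteristic polynomial,
    so this argument needs an eigenbasis. It is obtained from the unitary
    diagonalization of a Hermitian matrix over [R[i]]
    ([symmetric_diagonalization]); since the Hermitian form of a real matrix
    is the sum of the real form at the real and imaginary parts
    ([hermitian_form_ReIm]), hypotheses about real vectors are enough to
    control the complex eigenvectors. *)

Set Implicit Arguments.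
Unset Strict Implicit.
Unset Printing Implicit Defensive.

Import Order.TTheory GRing.Theory Num.Theory.
Local Open Scope ring_scope.

(** * Inertia from the factored characteristic polynomial *)

Lemma inertia_of_roots (R : rcfType) m (A : 'M[R]_m) (d : 'I_m -> R) :
  char_poly A = \prod_i ('X - (d i)%:P) ->
  inertia A = (#|[pred i | 0 < d i]|, #|[pred i | d i == 0]|,
               #|[pred i | d i < 0]|).
Proof.
move=> chA.
have multE a : eigmult A a = (\sum_i (d i == a))%N.
  rewrite /eigmult chA -(big_map d xpredT (fun b => 'X - b%:P)) mu_prod_XsubC.
  by rewrite -sum1_count big_mkcond big_map.
have sumE (P : pred R) :
    (\sum_(a <- eigvals A | P a) eigmult A a)%N = #|[pred i | P (d i)]|.
  under eq_bigr do rewrite multE.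
  rewrite exchange_big -sum1_card [RHS]big_mkcond /=; apply: eq_bigr => i _.
  have di : d i \in eigvals A.
    rewrite mem_eigvals eigenvalue_root_char chA.
    by rewrite (bigD1 i) //= rootM root_XsubC eqxx.
  rewrite big_mkcond (bigD1_seq (d i)) ?eigvals_uniq //= eqxx big1 ?addn0 //.
  by move=> a; rewrite eq_sym => /negPf->; case: ifP.
rewrite /inertia !sumE; congr (_, _, _).
by rewrite multE -sum1_card [RHS]big_mkcond; apply: eq_bigr => i _;
   rewrite inE; case: eqP.
Qed.

(** * Quadratic forms of matrices *)

Definition qform (R : comNzRingType) m (A : 'M[R]_m) (x : 'rV[R]_m) : R :=
  (x *m A *m x^T) 0 0.

(** Reindexing by the vertices themselves removes the enumeration hidden in a
    matrix indexed by ['I_#|V|]. *)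
Lemma qformE (R : comNzRingType) (V : finType) (A : 'M[R]_#|V|) (x : 'rV_#|V|) :
  qform A x = \sum_u \sum_v
    x 0 (enum_rank u) * A (enum_rank u) (enum_rank v) * x 0 (enum_rank v).
Proof.
rewrite /qform mxE exchange_big (reindex enum_rank) /=; last first.
  by exists enum_val => ? _; rewrite ?enum_valK ?enum_rankK.
apply: eq_bigr => v _; rewrite !mxE mulr_suml (reindex enum_rank) //=.
by exists enum_val => ? _; rewrite ?enum_valK ?enum_rankK.
Qed.

Lemma qform_delta2 (R : comNzRingType) m (A : 'M[R]_m) i j :
  qform A (delta_mx 0 i + delta_mx 0 j) = A i i + A i j + (A j i + A j j).
Proof.
rewrite /qform linearD /= !trmx_delta mulmxDl mulmxDr !mulmxDl -!rowE -!colE.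
by rewrite !mxE; ring.
Qed.

(** * Diagonalization of real symmetric matrices *)

Local Notation toC := (real_complex _).
Local Notation ReC := (@complex.Re _).
Local Notation ImC := (@complex.Im _).

(** The cross terms in [x + i y] cancel because the form is symmetric. *)
Lemma hermitian_form_ReIm (R : rcfType) m (A : 'M[R]_m) (z : 'rV[R[i]]_m) :
  A^T = A ->
  (z *m map_mx toC A *m (map_mx Num.conj z)^T) 0 0 =
  (qform A (map_mx ReC z) + qform A (map_mx ImC z))%:C%C.
Proof.
move=> Asym; set x := map_mx ReC z; set y := map_mx ImC z.
have zE : z = map_mx toC x + 'i%C *: map_mx toC y.
  by apply/matrixP => i j; rewrite !mxE -complexE.
have zcE : map_mx Num.conj z = map_mx toC x - 'i%C *: map_mx toC y.
  apply/matrixP => i j; rewrite !mxE; case: (z i j) => a b; simpc.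
  by rewrite /Num.conj /=; simpc.
clearbody x y.
have cross : (x *m A *m y^T) 0 0 = (y *m A *m x^T) 0 0.
  have <- : (x *m A *m y^T)^T 0 0 = (y *m A *m x^T) 0 0.
    by rewrite !trmx_mul trmxK Asym mulmxA.
  by rewrite [RHS]mxE.
rewrite zcE zE /qform linearB /= linearZ /= !map_trmx mulmxDl mulmxDl.
rewrite !mulmxBr -!scalemxAl -!scalemxAr -!map_mxM scalerA -expr2.
rewrite sqr_i scaleN1r.
set a := x *m A *m x^T; set b := x *m A *m y^T.
set c := y *m A *m x^T; set d := y *m A *m y^T.
rewrite -/b -/c in cross; clearbody a b c d.
rewrite !mxE cross rmorphD /=; ring.
Qed.

(** A real symmetric matrix is Hermitian over [R[i]], where a unitary [U]
    diagonalizes it with real eigenvalues. The rows of [U] may be complex, so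
    [c] holds complex coordinates in this eigenbasis; written out in real and
    imaginary parts, the identity of forms is an equation in [R] and can be
    combined with hypotheses on real vectors. *)
Lemma symmetric_diagonalization (R : rcfType) m (A : 'M[R]_m) :
    A^T = A ->
  exists (d : 'I_m -> R) (U : 'M[R[i]]_m),
  [/\ char_poly A = \prod_i ('X - (d i)%:P), U \in unitmx &
      forall c : 'rV[R[i]]_m,
        qform A (map_mx ReC (c *m U)) + qform A (map_mx ImC (c *m U)) =
        \sum_i d i * (ReC (c 0 i) ^+ 2 + ImC (c 0 i) ^+ 2)].
Proof.
move=> Asym; set AC := map_mx toC A.
have herm : AC \is hermsymmx.
  apply: realsym_hermsym.
    by apply/is_hermitianmxP; rewrite expr0 scale1r map_mx_id // map_trmx Asym.
  by apply/mxOverP => i j; rewrite mxE complex_real.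
have /orthomx_spectralP ACE := hermitian_normalmx herm.
have dreal := hermitian_spectral_diag_real herm.
set U := spectralmx AC in ACE; set D := spectral_diag AC in ACE dreal.
have Uunit : U \in unitmx := spectral_unit AC.
have Uunitary : U \is unitarymx := spectral_unitarymx AC.
pose d i := ReC (D 0 i).
have dE i : (d i)%:C%C = D 0 i by apply: RRe_real; exact: (mxOverP dreal).
exists d, U; split=> //.
- apply: (map_poly_inj (real_complex R)).
  rewrite map_char_poly -/AC rmorph_prod /=.
  transitivity (char_poly (diag_mx D)).
    (* Similar matrices have the same characteristic polynomial: conjugate
       the whole matrix 'X - A by U. *)
    rewrite {1}ACE /char_poly /char_poly_mx.
    set V := map_mx polyC U.
    have VU : V \in unitmx by rewrite unitmxE det_map_mx rmorph_unit -?unitmxE.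
    have -> : map_mx polyC (invmx U *m diag_mx D *m U) =
              invmx V *m map_mx polyC (diag_mx D) *m V.
      by rewrite !map_mxM map_invmx.
    have {1}-> : 'X%:M = invmx V *m 'X%:M *m V.
      by rewrite mul_mx_scalar -scalemxAl mulVmx // scalemx1.
    rewrite -mulmxBl -mulmxBr det_mulmx det_mulmx det_inv mulrAC.
    by rewrite mulVr ?mul1r.
  rewrite char_poly_trig ?diag_mx_is_trig //; apply: eq_bigr => i _.
  by rewrite rmorphB /= map_polyX map_polyC /= dE !mxE eqxx mulr1n.
- move=> c; apply: (@complexI R).
  rewrite -hermitian_form_ReIm // -/AC ACE invmx_unitary // rmorph_sum /=.
  rewrite map_mxM trmx_mul !map_trmx !mulmxA mulmxtVK // mulmxtVK //.
  rewrite mul_mx_diag mxE; apply: eq_bigr => i _; rewrite !mxE -dE rmorphM /=.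
  by rewrite mulrAC -normCK -add_Re2_Im2 mulrC.
Qed.

(** * Inertia of a form negative on a hyperplane *)

(** A form that is negative on the hyperplane [u^\perp] has at most one
    nonnegative eigenvalue, because the span of two eigenvectors meets the
    hyperplane; a positive value forces a positive eigenvalue. Together they
    leave no room for the eigenvalue 0. *)
Lemma inertia_hyperplane (R : rcfType) m (A : 'M[R]_m) (u : 'cV[R]_m)
    (y : 'rV[R]_m) :
    A^T = A ->
    (forall x : 'rV[R]_m, x *m u = 0 -> x != 0 -> qform A x < 0) ->
    0 < qform A y ->
  inertia A = (1%N, 0%N, m.-1).
Proof.
move=> Asym neg ypos.
have [d [U [chA Uunit qE]]] := symmetric_diagonalization Asym.
have [k dk] : exists k, 0 < d k.
  apply/existsP; apply: contraLR ypos; rewrite negb_exists => /forallP nd.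
  have := qE (map_mx toC y *m invmx U); rewrite mulmxKV // -!map_mx_comp.
  rewrite [X in qform A X + _](_ : _ = y); last first.
    by apply/matrixP => i j; rewrite !mxE.
  rewrite [X in _ + qform A X](_ : _ = 0); last first.
    by apply/matrixP => i j; rewrite !mxE.
  rewrite [X in _ + X](_ : _ = 0) ?addr0 => [->|]; last first.
    by rewrite /qform trmx0 mulmx0 mxE.
  rewrite -leNgt; apply: sumr_le0 => i _; rewrite mulr_le0_ge0 //.
    by rewrite leNgt nd.
  by rewrite addr_ge0 ?sqr_ge0.
have dneg i : i != k -> d i < 0.
  move=> ik; rewrite ltNge; apply/negP => di.
  (* The coordinates c of a combination of the eigenvectors k and i lying in
     the hyperplane; when eigenvector k is already there, it is taken alone,
     since the generic combination could vanish. *)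
  pose w := U *m map_mx toC u.
  pose c : 'rV[R[i]]_m := if w k 0 == 0 then delta_mx 0 k
    else w i 0 *: delta_mx 0 k - w k 0 *: delta_mx 0 i.
  have c0 : c != 0.
    rewrite /c; move: (w k 0) (w i 0) => a e.
    case: (a =P 0) => [_|/eqP wk]; apply/eqP.
      by move=> /matrixP/(_ 0 k); rewrite !mxE !eqxx => /eqP; rewrite oner_eq0.
    move=> /matrixP/(_ 0 i); rewrite !mxE !eqxx (negPf ik) => /eqP.
    by rewrite mulr0 mulr1 sub0r oppr_eq0 (negPf wk).
  have cw : c *m w = 0.
    apply/matrixP => ? j; rewrite !ord1 /c; case: (w k 0 =P 0) => [wk|_].
      by rewrite -rowE mxE wk mxE.
    by rewrite mulmxBl -!scalemxAl -!rowE !mxE; ring.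
  have csupp j : j != k -> j != i -> c 0 j = 0.
    move=> jk ji; rewrite /c; case: ifP => _;
    rewrite !mxE (negPf jk) ?(negPf ji) //=.
    by rewrite !mulr0 subr0.
  have qE' := qE c; set z := c *m U in qE'.
  have z0 : z != 0.
    apply: contraNneq c0 => z0.
    by rewrite -(mulmxK Uunit c) -/z z0 mul0mx.
  have zu : z *m map_mx toC u = 0 by rewrite -mulmxA.
  clearbody z.
  (* As u is real, the real and imaginary parts of z lie in the hyperplane. *)
  have Rez : map_mx ReC z *m u = 0.
    apply/matrixP => a b; move/matrixP/(_ a b)/(congr1 ReC): zu;
    rewrite !mxE raddf_sum /= => e0; rewrite -[RHS]e0.
    by apply: eq_bigr => j _; rewrite !mxE; case: (z a j) => ? ? /=;
       rewrite mulr0 subr0.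
  have Imz : map_mx ImC z *m u = 0.
    apply/matrixP => a b; move/matrixP/(_ a b)/(congr1 ImC): zu;
    rewrite !mxE raddf_sum /= => e0; rewrite -[RHS]e0.
    by apply: eq_bigr => j _; rewrite !mxE; case: (z a j) => ? ? /=;
       rewrite mulr0 add0r.
  have npos x : x *m u = 0 -> qform A x <= 0.
    have [->|x0 xu] := eqVneq x 0; first by rewrite /qform trmx0 mulmx0 mxE.
    exact/ltW/neg.
  have : 0 <= \sum_j d j * (ReC (c 0 j) ^+ 2 + ImC (c 0 j) ^+ 2).
    apply: sumr_ge0 => j _.
    have [->|jk] := eqVneq j k.
      by rewrite mulr_ge0 ?addr_ge0 ?sqr_ge0 // ltW.
    have [->|ji] := eqVneq j i; first by rewrite mulr_ge0 ?addr_ge0 ?sqr_ge0.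
    by rewrite csupp //= expr0n addr0 mulr0.
  rewrite -qE'; apply/negP; rewrite -ltNge.
  have [Re0|Re0] := eqVneq (map_mx ReC z) 0; last first.
    by rewrite ltr_wnDr ?neg ?npos.
  rewrite ltr_wnDl ?neg ?npos //.
  apply: contraNneq z0 => Im0; apply/eqP/matrixP => a b.
  have := congr1 (fun M : 'rV_m => M a b) Re0.
  have := congr1 (fun M : 'rV_m => M a b) Im0.
  by rewrite !mxE; case: (z a b) => ? ? /= -> ->.
rewrite (inertia_of_roots chA); congr (_, _, _).
- rewrite -(card1 k); apply: eq_card => i; rewrite !inE.
  by have [->|/dneg/lt_gtF] := eqVneq i k.
- apply: eq_card0 => i; rewrite inE; have [->|/dneg/lt_eqF //] := eqVneq i k.
  by rewrite gt_eqF.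
- rewrite -[m in RHS]card_ord -(cardC1 k); apply: eq_card => i; rewrite !inE.
  by have [->|/dneg] := eqVneq i k; first rewrite lt_gtF.
Qed.

(** * Distances in a starlike block graph *)

Section SmallDistances.
Variables (V : finType) (e : rel V).

Lemma gdist_refl u : gdist e u u = 0%N.
Proof. by have := @gdist_min V e u [::] isT; rewrite leqn0 => /eqP. Qed.

Lemma gdist_adj u v : u != v -> e u v -> gdist e u v = 1%N.
Proof.
move=> uv euv; have := @gdist_min V e u [:: v]; rewrite /= andbT => /(_ euv).
have [[|w p] [_ lp <-] //] := gdist_path (connect1 euv); last by case: p {lp}.
by move: lp uv => /= ->; rewrite eqxx.
Qed.

Lemma gdist_two u w v :
  u != v -> ~~ e u v -> e u w -> e w v -> gdist e u v = 2%N.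
Proof.
move=> uv neuv euw ewv; have := @gdist_min V e u [:: w; v].
rewrite /= andbT euw => /(_ ewv).
have cuv : connect e u v := connect_trans (connect1 euw) (connect1 ewv).
have [[|x [|y p]] [ep lp <-] //] := gdist_path cuv; last by case: p {ep lp}.
  by move: lp uv => /= ->; rewrite eqxx.
by move: ep neuv; rewrite -lp /= andbT => ->.
Qed.

End SmallDistances.

Lemma sum_option (V : nmodType) (I : finType) (F : option I -> V) :
  \sum_u F u = F None + \sum_x F (Some x).
Proof.
rewrite (bigD1 None) //=; congr (_ + _).
rewrite (reindex_omap Some id) => [|[] //].
by apply: eq_bigl => x; rewrite eqxx.
Qed.

Section StarlikeForm.
Variables (b : nat) (n : 'I_b -> nat).
Local Notation T := {i : 'I_b & 'I_(n i)}.

Lemma mem_starlike_block (x : T) i :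
  (Some x \in starlike_block n i) = (tag x == i).
Proof.
rewrite !inE /=; apply/imsetP/idP => [[y yi [->]]|xi].
  by rewrite inE in yi.
by exists x; rewrite ?inE.
Qed.

Lemma starlike_center (x : T) : starlike None (Some x).
Proof.
by apply/andP; split=> //; apply/existsP; exists (tag x);
   rewrite mem_starlike_block eqxx !inE.
Qed.

Lemma starlike_leaves (x y : T) :
  starlike (Some x) (Some y) = (x != y) && (tag x == tag y).
Proof.
congr (_ && _); apply/existsP/eqP => [[k]|xy].
  by rewrite !mem_starlike_block => /andP[/eqP-> /eqP->].
by exists (tag x); rewrite !mem_starlike_block xy eqxx.
Qed.

Lemma gdist_center (x : T) : gdist (@starlike b n) None (Some x) = 1%N.
Proof. exact/gdist_adj/starlike_center. Qed.

Lemma gdist_to_center (x : T) : gdist (@starlike b n) (Some x) None = 1%N.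
Proof. by apply: gdist_adj; rewrite // starlike_sym starlike_center. Qed.

(** Vertices of different blocks are joined through the centre. *)
Lemma gdist_leaves (x y : T) : gdist (@starlike b n) (Some x) (Some y) =
  (if x == y then 0 else if tag x == tag y then 1 else 2)%N.
Proof.
have [->|xy] := eqVneq x y; first exact: gdist_refl.
have sxy : Some x != Some y :> starlike_vertex n by [].
case: ifP => txy; first by apply: gdist_adj => //; rewrite starlike_leaves xy.
apply: (gdist_two (w := None)) => //; rewrite ?starlike_center //.
  by rewrite starlike_leaves txy andbF.
by rewrite starlike_sym starlike_center.
Qed.

Lemma gdist_starlike_sym u v :
  gdist (@starlike b n) u v = gdist (@starlike b n) v u.
Proof.
case: u v => [x|] [y|] //; last by rewrite gdist_center gdist_to_center.
  by rewrite !gdist_leaves eq_sym [tag x == _]eq_sym.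
by rewrite gdist_center gdist_to_center.
Qed.

(** * The quadratic form of the squared distance matrix *)

Section Form.
Variable R : realFieldType.
Variable (x : 'rV[R]_#|starlike_vertex n|).
Local Notation f v := (x 0 (enum_rank v)).

(** Twice the products [f0 g] come from the centre; the other entries are
    [4 - 3 [same block] - [equal]], and the sums over pairs of equal vertices
    and over pairs in the same block collapse to sums of squares. *)
Lemma starlike_qform : qform (sqdist_mx R (@starlike b n)) x =
  2 * f None * (\sum_y f (Some y)) + 4 * (\sum_y f (Some y)) ^+ 2
  - 3 * (\sum_i (\sum_(y | tag y == i) f (Some y)) ^+ 2)
  - \sum_y f (Some y) ^+ 2.
Proof.
rewrite qformE sum_option sum_option.
under [X in _ + X]eq_bigr do rewrite sum_option.
rewrite big_split /=.
rewrite mxE !enum_rankK gdist_refl mulr0 mul0r add0r.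
have -> : \sum_(y : T) f None * sqdist_mx R (@starlike b n) (enum_rank None)
    (enum_rank (Some y)) * f (Some y) = f None * \sum_y f (Some y).
  rewrite mulr_sumr; apply: eq_bigr => y _.
  by rewrite mxE !enum_rankK gdist_center mulr1.
have -> : \sum_(y : T) f (Some y) * sqdist_mx R (@starlike b n)
    (enum_rank (Some y)) (enum_rank None) * f None = f None * \sum_y f (Some y).
  rewrite mulr_sumr; apply: eq_bigr => y _.
  by rewrite mxE !enum_rankK gdist_to_center mulr1 mulrC.
have blocksE : \sum_i (\sum_(y | tag y == i) f (Some y)) ^+ 2 =
    \sum_y \sum_z (tag y == tag z)%:R * (f (Some y) * f (Some z)).
  rewrite [RHS](partition_big (@tag _ _) xpredT) //=; apply: eq_bigr => i _.
  rewrite expr2 mulr_suml; apply: eq_bigr => y /eqP <-.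
  rewrite mulr_sumr big_mkcond; apply: eq_bigr => z _.
  by rewrite eq_sym; case: eqP; rewrite ?mul1r ?mul0r.
have diagE : \sum_y f (Some y) ^+ 2 =
    \sum_y \sum_z (y == z)%:R * (f (Some y) * f (Some z)).
  apply: eq_bigr => y _; rewrite (bigD1 y) //= eqxx mul1r expr2.
  rewrite big1 ?addr0 // => z.
  by rewrite eq_sym => /negPf->; rewrite mul0r.
have -> : \sum_(y : T) \sum_(z : T) f (Some y) * sqdist_mx R (@starlike b n)
      (enum_rank (Some y)) (enum_rank (Some z)) * f (Some z) =
    4 * (\sum_y f (Some y)) ^+ 2
    - 3 * (\sum_i (\sum_(y | tag y == i) f (Some y)) ^+ 2)
    - \sum_y f (Some y) ^+ 2.
  rewrite blocksE diagE expr2 mulr_suml !mulr_sumr -!sumrB.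
  apply: eq_bigr => y _.
  rewrite !mulr_sumr -!sumrB; apply: eq_bigr => z _.
  rewrite mxE !enum_rankK gdist_leaves.
  have [->|yz] := eqVneq y z; first by rewrite eqxx /=; ring.
  by case: eqP => _ /=; ring.
ring.
Qed.

(** The normal vector of the hyperplane [f0 + 4 S = 0], where
    [2 f0 S + 4 S^2 = - 4 S^2] takes the sign of the other terms. *)
Definition starlike_normal : 'cV[R]_#|starlike_vertex n| :=
  \col_i (if enum_val i is None then 1 else 4).

(** Off the origin, [g] is nonzero: [g = 0] gives [S = 0], hence [f0 = 0] by the
    equation of the hyperplane. *)
Lemma starlike_qform_neg : x *m starlike_normal = 0 -> x != 0 ->
  qform (sqdist_mx R (@starlike b n)) x < 0.
Proof.
move=> /matrixP/(_ 0 0); rewrite !mxE (reindex enum_rank) /=; last first.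
  by exists enum_val => ? _; rewrite ?enum_valK ?enum_rankK.
rewrite sum_option mxE enum_rankK mulr1.
under eq_bigr do rewrite mxE enum_rankK.
rewrite -mulr_suml => xu x0; rewrite starlike_qform.
set S := \sum_y _ in xu *.
have -> : f None = - (S * 4) by apply/eqP; rewrite -addr_eq0 xu.
have S2 : 0 <= S ^+ 2 := sqr_ge0 S.
have blocks_ge0 : 0 <= \sum_i (\sum_(y : T | tag y == i) f (Some y)) ^+ 2.
  by apply: sumr_ge0 => i _; exact: sqr_ge0.
have leaves_gt0 : 0 < \sum_(y : T) f (Some y) ^+ 2.
  rewrite lt_def sumr_ge0 ?andbT => [|y _]; last exact: sqr_ge0.
  apply: contraNneq x0 => /eqP.
  rewrite psumr_eq0 => [/allP g0|y _]; last exact: sqr_ge0.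
  have f0 (y : T) : f (Some y) = 0.
    by apply/eqP; rewrite -sqrf_eq0; apply: g0; rewrite mem_index_enum.
  apply/eqP/rowP => i; rewrite mxE -(enum_valK i).
  case: (enum_val i) => [y|]; first exact: f0.
  by move: xu; rewrite /S big1 // mul0r addr0.
nra.
Qed.

End Form.

End StarlikeForm.

Theorem theorem2p10 (R : realType) (b : nat) (n : 'I_b -> nat)
    (hb : (2 <= b)%N) (hn : forall i : 'I_b, (0 < n i)%N) :
  inertia (sqdist_mx R (@starlike b n)) =
    (1%N, 0%N, ((1 + \sum_(i < b) n i) - 1)%N).
Proof.
(* The first vertex of the first block, adjacent to the centre. *)
pose y : {i : 'I_b & 'I_(n i)} :=
  Tagged (fun i => 'I_(n i)) (Ordinal (hn (Ordinal (ltnW hb)))).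
rewrite -card_starlike_vertex subn1.
apply: (inertia_hyperplane (u := starlike_normal n R)
          (y := delta_mx 0 (enum_rank None) + delta_mx 0 (enum_rank (Some y)))).
- by apply/matrixP => i j; rewrite !mxE gdist_starlike_sym.
- exact: starlike_qform_neg.
rewrite qform_delta2 !mxE !enum_rankK !gdist_refl gdist_center gdist_to_center.
lra.
Qed.
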